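(* Let $Y$ be a real vector space, $f:Y\to\overline{\mathbb{R}}$, $A:=\operatorname{epi}f\subseteq Y\times\mathbb{R}$ and $k:=(0_Y,-1)\in Y\times\mathbb{R}$. Let $F,B\subseteq Y$ with $F\ne\emptyset$. Then: (1) $f$ is $B$-monotone on $F$ if and only if $\varphi_{A,k}$ is $(B\times(-\mathbb{R}_{+}))$-monotone on $F\times\mathbb{R}$. (2) $\varphi_{A,k}$ is strictly $(B\times(-\mathbb{R}_{+}))$-monotone on $F\times\mathbb{R}$ if and only if (a) $f$ is strictly $B$-monotone on $F$, and (b) $f$ is finite-valued on $F$ or $0_Y\notin B$.
   Context: $\overline{\mathbb{R}}=\mathbb{R}\cup\{-\infty,+\infty\}$, $\inf\emptyset=+\infty$, $\mathbb{R}_{+}=\{x\in\mathbb{R}:x\ge0\}$, $\operatorname{epi}f=\{(y,t)\in Y\times\mathbb{R}:f(y)\le t\}$. The Gerstewitz functional $\varphi_{A,k}:Y\times\mathbb{R}\to\overline{\mathbb{R}}$ is $\varphi_{A,k}((y,s))=\inf\{t\in\mathbb{R}:(y,s)\in A+tk\}$. For a real vector space $Z$ and $F,B\subseteq Z$, a function $\varphi:Z\to\overline{\mathbb{R}}$ is $B$-monotone on $F$ if $z^1,z^2\in F$ and $z^2-z^1\in B$ imply $\varphi(z^1)\le\varphi(z^2)$; it is strictly $B$-monotone on $F$ if $z^1,z^2\in F$ and $z^2-z^1\in B\setminus\{0\}$ imply $\varphi(z^1)<\varphi(z^2)$. It is finite-valued on $F$ if it attains only real values on $F$. *)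

(* Defs.v *)
From mathcomp Require Import all_boot all_order all_algebra.
From mathcomp Require Import all_classical all_reals all_analysis.

Set Implicit Arguments.
Unset Strict Implicit.
Unset Printing Implicit Defensive.

Import Order.TTheory GRing.Theory Num.Theory.

Local Open Scope classical_set_scope.
Local Open Scope ring_scope.

(* The second factor is R^o, i.e. R as a vector space over itself, so that
   Y * R^o is the product vector space Y x R. *)
Definition epi (R : realType) (Y : lmodType R) (f : Y -> \bar R) :
    set (Y * R^o)%type :=
  [set p | (f p.1 <= p.2%:E)%E].

(* [ereal_inf] of the empty set is +oo. *)
Definition gerstewitz (R : realType) (Z : lmodType R) (A : set Z) (k : Z)
    (z : Z) : \bar R :=
  ereal_inf (EFin @` [set t : R | [set a + t *: k | a in A] z]).

Definition monotone_on (R : realType) (Z : lmodType R) (B F : set Z)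
    (phi : Z -> \bar R) : Prop :=
  forall z1 z2 : Z, F z1 -> F z2 -> B (z2 - z1) -> (phi z1 <= phi z2)%E.

Definition strictly_monotone_on (R : realType) (Z : lmodType R) (B F : set Z)
    (phi : Z -> \bar R) : Prop :=
  forall z1 z2 : Z, F z1 -> F z2 -> (B `\ 0) (z2 - z1) -> (phi z1 < phi z2)%E.

Definition finite_valued_on (R : realType) (Z : Type) (F : set Z)
    (phi : Z -> \bar R) : Prop :=
  forall z : Z, F z -> phi z \is a fin_num.

(* Main.v *)
(* For A = epi f and k = (0, -1), the point (y, s) lies in A + t k iff
   f y <= s + t, so the Gerstewitz functional is (y, s) |-> f y - s. Moving
   s by a nonzero amount with y fixed is strict exactly when f y is finite,
   which is where condition (b) comes from. *)
Require Import Defs.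
From mathcomp Require Import all_boot all_order all_algebra.
From mathcomp Require Import all_classical all_reals all_analysis.

Set Implicit Arguments.
Unset Strict Implicit.
Unset Printing Implicit Defensive.

Import Order.TTheory GRing.Theory Num.Theory.

Local Open Scope classical_set_scope.
Local Open Scope ring_scope.

(** A real [x] belongs to the set and so attains the infimum; for [+oo] the set is empty, and for
    [-oo] it contains every real. *)
Lemma ereal_inf_EFin_ge (R : realType) (x : \bar R) :
  ereal_inf (EFin @` [set t : R | (x <= t%:E)%E]) = x.
Proof.
apply/eqP; rewrite eq_le; apply/andP; split; last first.
  by apply: le_ereal_inf_tmp => _ [t /= xt <-].
case: x => [r| |].
- by apply: ereal_inf_lbound; exists r => /=.
- exact: leey.
- suff -> : ereal_inf (EFin @` [set t : R | (-oo <= t%:E)%E]) = -oo%E by [].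
  by apply: eq_ninfty => r; apply: ereal_inf_lbound; exists r; rewrite /= ?leNye.
Qed.

Lemma gerstewitz_epi (R : realType) (Y : lmodType R) (f : Y -> \bar R)
    (y : Y) (s : R) :
  gerstewitz (epi f) ((0, -1) : (Y * R^o)%type) (y, s) = (f y - s%:E)%E.
Proof.
rewrite /gerstewitz -[RHS]ereal_inf_EFin_ge; congr (ereal_inf (EFin @` _)).
apply/seteqP; split => t /=.
  case=> -[a1 a2]; rewrite /epi /= => fa [].
  rewrite scaler0 addr0 => <- <-.
  by rewrite EFinN leeBlDr// -EFinD scalerN [t *: 1]mulr1 addrC subrK.
(* Solving [a + t *: k = (y, s)] with [k = (0, -1)] forces [a = (y, t + s)]. *)
rewrite EFinN leeBlDr// -EFinD => fyt; exists (y, t + s) => //=.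
congr (_, _); rewrite /= ?scaler0 ?addr0//.
by rewrite scalerN [t *: 1]mulr1 addrAC subrr add0r.
Qed.

Theorem proposition20 (R : realType) (Y : lmodType R) (f : Y -> \bar R)
    (F B : set Y) (hF : F !=set0) :
  let A : set (Y * R^o)%type := epi f in
  let k : (Y * R^o)%type := (0, -1) in
  let C : set (Y * R^o)%type := B `*` [set - x | x in [set x : R | 0 <= x]] in
  let FR : set (Y * R^o)%type := F `*` [set: R^o] in
  (monotone_on B F f <-> monotone_on C FR (gerstewitz A k)) /\
  (strictly_monotone_on C FR (gerstewitz A k) <->
   strictly_monotone_on B F f /\ (finite_valued_on F f \/ ~ B 0)).
Proof.
move=> A k C FR.
have CE b t : C (b, t) <-> B b /\ t <= 0.
  split=> [[/= Bb [x x0 <-]]|[Bb t0]]; first by split=> //; rewrite oppr_le0.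
  by split=> //; exists (- t); rewrite /= ?oppr_ge0 ?opprK.
split; split.
- move=> fm [y1 s1] [y2 s2] [Fy1 _] [Fy2 _] /CE[By].
  rewrite subr_le0 => s21; rewrite !gerstewitz_epi.
  by apply: leeB; [exact: fm|rewrite lee_fin].
- move=> phim y1 y2 Fy1 Fy2 By.
  (* At height 0 the functional takes the value [f y], so its monotonicity restricts to that of
     [f]. *)
  have := phim (y1, 0) (y2, 0); rewrite !gerstewitz_epi !sube0; apply=> //.
  by apply/CE; rewrite /= subrr.
- move=> phim; split.
    move=> y1 y2 Fy1 Fy2 [By y0].
    have := phim (y1, 0) (y2, 0); rewrite !gerstewitz_epi !sube0; apply=> //.
    split; first by apply/CE; rewrite /= subrr.
    by move=> -[/y0].
  have [B0|nB0] := pselect (B 0); [left|by right].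
  move=> y Fy.
  (* Since [B 0] holds, a purely vertical step is allowed; strictness then gives [f y - 1 < f y],
     which fails when [f y] is infinite. *)
  have C01 : (C `\ 0) ((y, 0) - (y, 1)).
    have -> : (y, 0) - (y, 1) = (0, -1) :> (Y * R^o)%type.
      by congr (_, _); rewrite /= ?subrr ?sub0r.
    split; first by apply/CE; rewrite lerN10.
    by move=> [] /eqP; rewrite oppr_eq0 oner_eq0.
  have := phim (y, 1) (y, 0) (conj Fy I) (conj Fy I) C01.
  by rewrite !gerstewitz_epi; case: (f y).
- move=> [fm finB] [y1 s1] [y2 s2] [Fy1 _] [Fy2 _] [/CE[By]].
  rewrite subr_le0 => s21 ne0; rewrite !gerstewitz_epi.
  have [y12|y12] := eqVneq y1 y2; last first.
    (* The strict step comes from [f] at the fixed height [s1]; lowering the height to [s2] can only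
       increase the value. *)
    apply: (@lt_le_trans _ _ (f y2 - s1%:E)%E).
      rewrite lteBlDr// subeK//; apply: fm => //; split=> // /eqP.
      by rewrite subr_eq0 eq_sym; apply/negP.
    by apply: leeB; rewrite ?lee_fin.
  (* With equal first coordinates [B 0] holds, so [f y2] is finite and cancels; strictness must come
     from [s2 < s1]. *)
  move: By ne0; rewrite /= y12 subrr => B0 ne0.
  case: finB => [fin|/(_ B0)//].
  rewrite -(fineK (fin _ Fy2)) -!EFinB lte_fin ltrD2l ltrN2 lt_neqAle s21 andbT.
  by apply/eqP => s12; apply: ne0; congr (_, _); rewrite /= ?s12 subrr.
Qed.
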